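(* Let $G$ be a connected graph of order $n$ with diameter $d$, where $n\geq 2$. Then $$\lambda_2(D(G))\leq \frac{n(d-1)}{2}-d,$$ and equality holds if and only if $G\cong K_n$ or $G\cong K_{\frac n2,\frac n2}$ (the latter case being possible only when $n$ is even).
   Context: All graphs are finite, simple, undirected and connected; the order of a graph is its number of vertices. For a connected graph $G$ with vertex set $\{v_1,\dots,v_n\}$, the distance $d_G(v_i,v_j)$ is the length of a shortest path from $v_i$ to $v_j$, and the diameter of $G$ is the maximum distance between any two vertices. The distance matrix $D(G)$ is the real symmetric $n\times n$ matrix whose $(i,j)$-entry is $d_G(v_i,v_j)$. Its eigenvalues, with multiplicity, are written $\lambda_1(D(G))\geq\lambda_2(D(G))\geq\cdots\geq\lambda_n(D(G))$. $K_n$ is the complete graph on $n$ vertices and $K_{a,b}$ is the complete bipartite graph with parts of sizes $a$ and $b$. *)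

(* Defs.v *)
From HB Require Import structures.
From mathcomp Require Import all_boot all_order all_algebra.
From mathcomp Require Import polyrcf.

Set Implicit Arguments.
Unset Strict Implicit.
Unset Printing Implicit Defensive.

Import Order.TTheory GRing.Theory Num.Theory.
Local Open Scope ring_scope.

Record sgraph := SGraph {
  vertex :> finType;
  adj : rel vertex;
  adj_sym : symmetric adj;
  adj_irrefl : irreflexive adj
}.

Section Graph.
Variable G : sgraph.

Definition connected_graph : Prop := forall x y : G, connect (@adj G) x y.

(* The tuple p lists the vertices after x, so its size is the number of edges *)
(* of the path.                                                               *)
Definition has_path_of_length (x y : G) (k : nat) : bool :=
  [exists p : k.-tuple G,
     [&& path (@adj G) x p, uniq (x :: p) & last x p == y]].

(* The least k < #|G| such that has_path_of_length x y k, or #|G| if there is *)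
(* none, i.e., if y is not reachable from x.                                  *)
Definition gdist (x y : G) : nat :=
  find (has_path_of_length x y) (iota 0 #|G|).

Definition diameter : nat := (\max_(x : G) \max_(y : G) gdist x y)%N.

Definition dist_mx (R : nzRingType) : 'M[R]_#|G| :=
  \matrix_(i, j) (gdist (enum_val i) (enum_val j))%:R.

Lemma has_path_ltn x y k : has_path_of_length x y k -> (k < #|G|)%N.
Proof.
case/existsP=> p /and3P[_ Up _].
by have /card_uniqP := Up; rewrite /= size_tuple => <-; apply: max_card.
Qed.

Lemma connect_has_path x y :
  connect (@adj G) x y = [exists k : 'I_#|G|, has_path_of_length x y k].
Proof.
apply/connectP/existsP => [[p xp ->] | [k /existsP[p /and3P[xp _ /eqP <-]]]].
  case/shortenP: xp => q xq Uq _.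
  have hq : has_path_of_length x (last x q) (size q).
    by apply/existsP; exists (in_tuple q); rewrite xq Uq eqxx.
  by exists (Ordinal (has_path_ltn hq)).
by exists p.
Qed.

Lemma gdistP x y : connect (@adj G) x y ->
  has_path_of_length x y (gdist x y) /\
  (forall k, has_path_of_length x y k -> (gdist x y <= k)%N).
Proof.
rewrite connect_has_path => /existsP[k0 hk0].
have hs : has (has_path_of_length x y) (iota 0 #|G|).
  by apply/hasP; exists (k0 : nat) => //; rewrite mem_iota /= add0n.
split=> [|k hk].
  have := nth_find 0%N hs; rewrite nth_iota ?add0n //.
  by rewrite -[X in (_ < X)%N](size_iota 0) -has_find.
rewrite leqNgt; apply/negP => ltk.
by have := before_find 0%N ltk; rewrite nth_iota ?add0n ?hk // (has_path_ltn hk).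
Qed.

End Graph.

Definition isomorphic (G H : sgraph) : Prop :=
  exists2 f : G -> H, bijective f & forall x y : G, adj (f x) (f y) = adj x y.

Section Complete.
Variable n : nat.

Definition complete_adj : rel 'I_n := fun x y => x != y.

Lemma complete_adj_sym : symmetric complete_adj.
Proof. by move=> x y; rewrite /complete_adj eq_sym. Qed.

Lemma complete_adj_irrefl : irreflexive complete_adj.
Proof. by move=> x; rewrite /complete_adj eqxx. Qed.

Definition complete_graph : sgraph :=
  SGraph complete_adj_sym complete_adj_irrefl.

End Complete.

Section CompleteBipartite.
Variables a b : nat.

Definition bipartite_adj : rel ('I_a + 'I_b)%type := fun x y =>
  match x, y with
  | inl _, inr _ | inr _, inl _ => true
  | _, _ => false
  end.

Lemma bipartite_adj_sym : symmetric bipartite_adj.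
Proof. by move=> [x|x] [y|y]. Qed.

Lemma bipartite_adj_irrefl : irreflexive bipartite_adj.
Proof. by case. Qed.

Definition complete_bipartite : sgraph :=
  SGraph bipartite_adj_sym bipartite_adj_irrefl.

End CompleteBipartite.

Section Eigenvalues.
Variables (R : rcfType) (n : nat).
Implicit Type M : 'M[R]_n.

(* The eigenvalues of M lying in R, in non-increasing order and repeated      *)
(* according to their multiplicity as roots of the characteristic polynomial. *)
(* There are exactly n of them when M is symmetric.                           *)
Definition eigenvalues M : seq R :=
  sort >=%R (flatten [seq nseq (mup x (char_poly M)) x
                     | x <- rootsR (char_poly M)]).

(* Indices start at 1: lambda_ 1 M is the largest eigenvalue. *)
Definition lambda_ (k : nat) M : R := nth 0 (eigenvalues M) k.-1.

Lemma count_eigenvalues M x :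
  count_mem x (eigenvalues M) = mup x (char_poly M).
Proof.
have nz : char_poly M != 0 := monic_neq0 (char_poly_monic M).
rewrite count_sort count_flatten -map_comp sumnE big_map.
under eq_bigr => y _ do rewrite /= count_nseq /=.
have Ur : uniq (rootsR (char_poly M)) by apply: uniq_roots.
have memr : (x \in rootsR (char_poly M)) = root (char_poly M) x.
  by rewrite -(roots_on_rootsR nz).
have [rx | nrx] := boolP (root (char_poly M) x).
  rewrite (bigD1_seq x) ?memr //= eqxx mul1n big1 ?addn0 // => y /negbTE yx.
  by rewrite yx.
rewrite mupNroot // big1_seq // => y /andP[_ yr].
by have [eyx | //] := eqVneq y x; rewrite -memr -eyx yr in nrx.
Qed.

Lemma mem_eigenvalues M x : (x \in eigenvalues M) = eigenvalue M x.
Proof.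
have nz : char_poly M != 0 := monic_neq0 (char_poly_monic M).
by rewrite -has_pred1 has_count count_eigenvalues -XsubC_dvd // dvdp_XsubCl
           eigenvalue_root_char.
Qed.

Lemma eigenvalues_sorted M : sorted >=%R (eigenvalues M).
Proof. by apply: sort_sorted => x y; apply: le_total. Qed.

End Eigenvalues.

(* Main.v *)
Require Import Defs.
From mathcomp Require Import all_boot all_order all_algebra.
From mathcomp Require Import ring lra.
From mathcomp Require Import complex.

(** Write [D] for the distance matrix, [n] for the order, [d] for the diameter
    and [c] for the bound [n (d - 1) / 2 - d].

    By the Courant-Fischer principle ([lambda2_attained_orthogonal]) there is
    a nonzero vector [f] with entries summing to 0 such that
    [lambda_2 |f|^2 <= f D f^T]. Since the sum of [f] is zero, one may subtract
    the constant [(d + 1) / 2] from every entry of [D] without changing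
    [f D f^T]; the off-diagonal entries then lie between [- (d - 1) / 2] and
    [(d - 1) / 2], and [c] is the largest possible row sum of absolute values,
    counting the diagonal entry [- (d + 1) / 2] with its sign. Written as a sum
    of squares ([sum_deficit]), this gives
      [4 (c |f|^2 - f D f^T) = \sum_(x != y)
         ((d - D x y) (f x + f y)^2 + (D x y - 1) (f x - f y)^2)],
    where every term is nonnegative because [1 <= D x y <= d].

    If [lambda_2 = c], all these terms vanish. When [d <= 1] the graph is
    complete. Otherwise [f y = - f x] for adjacent [x] and [y], and [f y = f x]
    for distinct nonadjacent ones, so that [f] takes two opposite nonzero
    values, equally often, and the sign of [f] is the bipartition of a balanced
    complete bipartite graph ([lambda2_eq_bound_bipartition]).

    Conversely, in both families of graphs, [c] is an eigenvalue of [D] and the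
    constant vector belongs to a larger one, so that [c <= lambda_2]. *)

Set Implicit Arguments.
Unset Strict Implicit.
Unset Printing Implicit Defensive.

Import Order.TTheory GRing.Theory Num.Theory.
Local Open Scope ring_scope.

(** * The second eigenvalue of a real symmetric matrix *)

(** A real symmetric matrix is diagonalisable over the real closed field
    itself: over [R[i]] it is Hermitian, hence similar to a real diagonal
    matrix, and two real matrices similar over [R[i]] are similar over [R].
    The rows of [P] are eigenvectors of [A]. *)
Lemma symmetric_diagonalizable (R : rcfType) (n : nat) (A : 'M[R]_n) :
  A^T = A -> exists2 P : 'M[R]_n, P \in unitmx &
    exists d : 'rV[R]_n, P *m A = diag_mx d *m P.
Proof.
move=> symA; pose toC := [the {rmorphism R -> R[i]} of real_complex R].
pose ReM m p (M : 'M[R[i]]_(m, p)) := map_mx (@complex.Re R) M.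
have realK m p (M : 'M[R[i]]_(m, p)) : M \is a mxOver Num.real ->
    map_mx toC (ReM m p M) = M.
  move=> /mxOverP Mr; apply/matrixP=> i j; rewrite !mxE; exact: RRe_real.
have realC m p (M : 'M[R]_(m, p)) : map_mx toC M \is a mxOver Num.real.
  by apply/mxOverP => i j; rewrite mxE; apply/complex_realP; exists (M i j).
pose B := map_mx toC A.
have hB : B \is hermsymmx.
  apply: realsym_hermsym; last exact: realC.
  by apply/is_hermitianmxP; rewrite expr0 scale1r map_mx_id // map_trmx symA.
have dr := hermitian_spectral_diag_real hB.
have /orthomx_spectralP defB := hermitian_normalmx hB.
have simB : similar_in unitmx B (diag_mx (spectral_diag B)).
  exists (spectralmx B); first exact: spectral_unit.
  apply/similarP; first exact: spectral_unit.
  have := congr1 (mulmx (spectralmx B)) defB.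
  by rewrite !mulmxA mulmxV ?spectral_unit // mul1mx.
have diagr : diag_mx (spectral_diag B) \is a mxOver Num.real.
  apply/mxOverP => i j; rewrite mxE rpredMn //.
  by move/mxOverP: dr; apply.
have [Q /= /andP[Qr Qu] /(similarP Qu) defQ] := real_similar simB (realC _ _ A) diagr.
exists (ReM _ _ Q); first by rewrite -(map_unitmx toC) realK.
exists (ReM _ _ (spectral_diag B)).
apply: (@map_mx_inj _ _ toC); rewrite !map_mxM map_diag_mx !realK //.
Qed.

Lemma char_poly_diagonalized (R : fieldType) (n : nat) (A P : 'M[R]_n)
    (d : 'rV[R]_n) : P \in unitmx -> P *m A = diag_mx d *m P ->
  char_poly A = \prod_(i < n) ('X - (d 0 i)%:P).
Proof.
move=> Pu defA.
have -> : \prod_(i < n) ('X - (d 0 i)%:P) = char_poly (diag_mx d).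
  rewrite char_poly_trig ?diag_mx_is_trig //.
  by apply: eq_bigr => i _; rewrite mxE eqxx.
have Pnz : \det (map_mx polyC P) != 0.
  by rewrite det_map_mx polyC_eq0 -unitfE -unitmxE.
apply: (mulfI Pnz); rewrite /char_poly -det_mulmx [RHS]mulrC -det_mulmx.
congr (\det _); rewrite /char_poly_mx mulmxBr mulmxBl -!map_mxM defA.
by rewrite scalar_mxC.
Qed.

Lemma mup_prod_XsubC (R : fieldType) (s : seq R) (x : R) :
  mup x (\prod_(a <- s) ('X - a%:P)) = count_mem x s.
Proof.
elim: s => [|a s IHs]; first by rewrite big_nil mupNroot ?root1.
rewrite big_cons mupM ?polyXsubC_eq0 ?monic_neq0 ?monic_prod_XsubC // IHs /=.
by rewrite -['X - _]expr1 mup_XsubCX; congr addn; case: eqP.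
Qed.

(** Together with [symmetric_diagonalizable], this says that a symmetric
    matrix of size [n] has exactly [n] eigenvalues, counted with
    multiplicity. *)
Lemma perm_eigenvalues (R : rcfType) (n : nat) (A P : 'M[R]_n)
    (d : 'rV[R]_n) : P \in unitmx -> P *m A = diag_mx d *m P ->
  perm_eq (eigenvalues A) [seq d 0 i | i : 'I_n].
Proof.
move=> Pu defA; apply/allP => x _ /=; rewrite count_eigenvalues.
rewrite (char_poly_diagonalized Pu defA) -mup_prod_XsubC.
by rewrite big_image.
Qed.

Section DotProduct.
Variables (R : realDomainType) (n : nat).
Implicit Types u v : 'rV[R]_n.

(** The standard inner product of two row vectors. *)
Definition dot u v : R := \sum_i u 0 i * v 0 i.

Lemma dotE u v : dot u v = (u *m v^T) 0 0.
Proof. by rewrite mxE; apply: eq_bigr => i _; rewrite mxE. Qed.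

Lemma dotC u v : dot u v = dot v u.
Proof. by apply: eq_bigr => i _; rewrite mulrC. Qed.

Lemma dotDl u v w : dot (u + v) w = dot u w + dot v w.
Proof. by rewrite !dotE mulmxDl mxE. Qed.

Lemma dotZl a u v : dot (a *: u) v = a * dot u v.
Proof. by rewrite !dotE -scalemxAl mxE. Qed.

Lemma dot_ge0 u : 0 <= dot u u.
Proof. by apply: sumr_ge0 => i _; rewrite -expr2 sqr_ge0. Qed.

Lemma dot_mul_symmetric (A : 'M[R]_n) u v : A^T = A ->
  dot (u *m A) v = dot u (v *m A).
Proof. by move=> symA; rewrite !dotE trmx_mul symA mulmxA. Qed.

End DotProduct.

(** Once [2 <= n], the default value used by [nth] in [lambda_] plays no
    role: [lambda_ 2 A] is a diagonal entry, and a second one dominates it. *)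
Lemma lambda2_le_two (R : rcfType) (n : nat) (A P : 'M[R]_n) (d : 'rV[R]_n) :
    (2 <= n)%N -> P \in unitmx -> P *m A = diag_mx d *m P ->
  exists i j : 'I_n, [/\ i != j, lambda_ 2 A <= d 0 i & lambda_ 2 A <= d 0 j].
Proof.
move=> n_ge2 Pu defA; have permA := perm_eigenvalues Pu defA.
have := perm_size permA; rewrite size_image card_ord.
have := eigenvalues_sorted A; have /permP cntA := permA.
have := cntA (>= lambda_ 2 A); rewrite count_map.
rewrite /lambda_ /=; case: (eigenvalues A) => [|a [|b s]] /=; last first.
- rewrite /= lexx => cnt /andP[ab _] _; rewrite ab in cnt.
  have /card_gt1P[i [j [Hi Hj ij]]]: (1 < #|[pred i | (b <= d 0 i)%R]|)%N.
    by rewrite cardE /enum_mem size_filter -enumT -cnt.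
  by exists i, j.
- by move=> _ _ n1; rewrite -n1 in n_ge2.
- by move=> _ _ n1; rewrite -n1 in n_ge2.
Qed.

(** The Courant-Fischer inequality for the second eigenvalue: every
    hyperplane contains a nonzero vector whose Rayleigh quotient is at least
    the second largest eigenvalue. The vector is found in the plane spanned by
    two eigenvectors with eigenvalues at least [lambda_ 2 A]. *)
Lemma lambda2_attained_orthogonal (R : rcfType) (n : nat) (A : 'M[R]_n)
    (c : 'rV[R]_n) : (2 <= n)%N -> A^T = A ->
  exists v : 'rV[R]_n,
    [/\ v != 0, dot v c = 0 & lambda_ 2 A * dot v v <= dot (v *m A) v].
Proof.
move=> n_ge2 symA; have [P Pu [d defA]] := symmetric_diagonalizable symA.
have [i [j [ij le_i le_j]]] := lambda2_le_two n_ge2 Pu defA.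
pose u := row i P; pose w := row j P.
have eig k : row k P *m A = d 0 k *: row k P.
  by rewrite -row_mul defA row_mul row_diag_mx -scalemxAl -rowE.
have lin a b : a *: u + b *: w = 0 -> a = 0 /\ b = 0.
  move=> E.
  have : (a *: delta_mx 0 i + b *: delta_mx 0 j) *m P = 0 :> 'rV_n.
    by rewrite mulmxDl -!scalemxAl -!rowE.
  move/(congr1 (mulmx^~ (invmx P))); rewrite mulmxK // mul0mx => /rowP E0.
  have := E0 i; have := E0 j; rewrite !mxE !eqxx (negPf ij) eq_sym (negPf ij).
  by rewrite !mulr0 !mulr1 addr0 add0r.
(* The Rayleigh quotient is large on the whole plane spanned by u and w. *)
have key a b (v := a *: u + b *: w) : lambda_ 2 A * dot v v <= dot (v *m A) v.
  (* The eigenvectors u and w need not be orthogonal when their eigenvalues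
     coincide, but then all of their combinations are eigenvectors. *)
  have orth : d 0 i = d 0 j \/ dot u w = 0.
    have := dot_mul_symmetric u w symA; rewrite !eig dotZl [RHS]dotC dotZl.
    have [->|ne] := eqVneq (d 0 i) (d 0 j); first by left.
    move/eqP; rewrite [dot w u]dotC -subr_eq0 -mulrBl mulf_eq0 subr_eq0 (negPf ne).
    by move/eqP; right.
  rewrite mulmxDl -!scalemxAl !eig -/u -/w !(dotDl, dotZl) ![dot _ v]dotC.
  rewrite !(dotDl, dotZl) [dot w u]dotC.
  have := dot_ge0 u; have := dot_ge0 w.
  case: orth => [E|->]; last first.
    rewrite !mulr0 !addr0 !add0r => ww uu.
    rewrite [leLHS](_ : _ = lambda_ 2 A * (a ^+ 2 * dot u u) +
      lambda_ 2 A * (b ^+ 2 * dot w w)); last by ring.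
    rewrite [leRHS](_ : _ = d 0 i * (a ^+ 2 * dot u u) +
      d 0 j * (b ^+ 2 * dot w w)); last by ring.
    by apply: lerD; rewrite ler_wpM2r // mulr_ge0 // sqr_ge0.
  have := dot_ge0 v; rewrite dotDl !dotZl ![dot _ v]dotC !(dotDl, dotZl).
  rewrite [dot w u]dotC -E => vv _ _.
  rewrite [leRHS](_ : _ = d 0 i * (a * (a * dot u u + b * dot u w) +
    b * (a * dot u w + b * dot w w))); last by ring.
  exact: ler_wpM2r.
have [/eqP u0|u0] := boolP (dot u c == 0).
  exists u; split=> //; last by have := key 1 0; rewrite scale1r scale0r addr0.
  apply/eqP=> E; have [] := lin 1 0; first by rewrite E scaler0 scale0r addr0.
  by move/eqP; rewrite oner_eq0.
exists (- dot w c *: u + dot u c *: w); split=> //.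
  by apply: contra_neqN u0 => /eqP /lin[_ ->].
by rewrite dotDl !dotZl; ring.
Qed.

Lemma lt_eigenvalues_lambda2 (R : rcfType) (n : nat) (A : 'M[R]_n) (a b : R) :
  eigenvalue A a -> eigenvalue A b -> a < b -> a <= lambda_ 2 A.
Proof.
rewrite -!mem_eigenvalues /lambda_ /=.
have := eigenvalues_sorted A; case: (eigenvalues A) => [|x [|y s]] //=.
  by move=> _; rewrite !inE => /eqP-> /eqP->; rewrite ltxx.
case/andP=> xy ys; rewrite !inE.
have /allP ley : all (<= y) s.
  by apply: order_path_min ys => p q r pq rp; apply: le_trans rp pq.
case/predU1P=> [->|/predU1P[->|/ley]//].
case/predU1P=> [->|]; first by rewrite ltxx.
move=> b_ys; rewrite ltNge (le_trans _ xy) //.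
by case/predU1P: b_ys => [->|/ley].
Qed.

(** * Distances in a graph *)

Section Distance.
Variable G : sgraph.
Implicit Types x y z : G.

Lemma has_path_of_length0 x y : has_path_of_length x y 0 = (x == y).
Proof.
apply/existsP/eqP => [[p]|->]; first by rewrite tuple0 => /and3P[_ _ /eqP].
by exists [tuple]; rewrite /= eqxx.
Qed.

Lemma has_path_of_length1 x y : has_path_of_length x y 1 = adj x y.
Proof.
apply/existsP/idP => [[p]|xy].
  by case/tupleP: p => z p; rewrite tuple0 /= => /and3P[/andP[xz _] _ /eqP<-].
exists [tuple y]; rewrite /= xy eqxx inE !andbT.
by apply: contraTneq xy => ->; rewrite adj_irrefl.
Qed.

Lemma has_path_of_length_sym x y k :
  has_path_of_length x y k = has_path_of_length y x k.
Proof.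
wlog suff: x y / has_path_of_length x y k -> has_path_of_length y x k.
  by move=> W; apply/idP/idP; apply: W.
case/existsP=> p /and3P[xp Up /eqP lp]; apply/existsP.
have sz : size (rev (belast x p)) == k by rewrite size_rev size_belast size_tuple.
exists (Tuple sz); rewrite -[y]lp [tval (Tuple sz)]/(rev (belast x p)).
have -> : uniq (last x p :: rev (belast x p)).
  by rewrite -rev_rcons -lastI rev_uniq.
have -> : last (last x p) (rev (belast x p)) = x.
  by case: (tval p) => //= a s; rewrite rev_cons last_rcons.
by rewrite eqxx !andbT rev_path; under eq_path do rewrite adj_sym.
Qed.

Lemma gdist_sym x y : gdist x y = gdist y x.
Proof. by apply: eq_find => k; apply: has_path_of_length_sym. Qed.

Hypothesis connG : connected_graph G.

Lemma gdist_eq0 x y : (gdist x y == 0%N) = (x == y).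
Proof.
have [p min] := gdistP (connG x y); apply/eqP/idP => [d0|].
  by rewrite -has_path_of_length0 -d0.
by rewrite -has_path_of_length0 => /min; rewrite leqn0 => /eqP.
Qed.

Lemma gdist_eq1 x y : (gdist x y == 1%N) = adj x y.
Proof.
have [p min] := gdistP (connG x y); apply/eqP/idP => [d1|xy].
  by rewrite -has_path_of_length1 -d1.
apply/eqP; rewrite eqn_leq min ?has_path_of_length1 // lt0n gdist_eq0.
by apply: contraTneq xy => ->; rewrite adj_irrefl.
Qed.

Lemma gdist_le2 x z y : x != y -> adj x z -> adj z y -> (gdist x y <= 2)%N.
Proof.
move=> xy xz zy; have [_] := gdistP (connG x y); apply.
apply/existsP; exists [tuple z; y]; rewrite /= xz zy eqxx !inE negb_or xy !andbT.
by rewrite /=; apply/andP; split; [move: xz|move: zy];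
  apply: contraTneq => ->; rewrite adj_irrefl.
Qed.

Lemma gdist_le_diameter x y : (gdist x y <= diameter G)%N.
Proof.
apply: leq_trans (leq_bigmax x); exact: (leq_bigmax (F := fun y => gdist x y)).
Qed.

Lemma diameter_le k : (forall x y, (gdist x y <= k)%N) -> (diameter G <= k)%N.
Proof. by move=> le_k; apply/bigmax_leqP => x _; apply/bigmax_leqP. Qed.

Lemma diameter_le1_complete x y : (diameter G <= 1)%N -> adj x y = (x != y).
Proof.
move=> d1; rewrite -gdist_eq1 -gdist_eq0.
by have := leq_trans (gdist_le_diameter x y) d1; case: gdist => [|[]].
Qed.

Lemma complete_gdist : (forall x y, adj x y = (x != y)) ->
  forall x y, gdist x y = (x != y).
Proof.
move=> adjG x y; have [->|xy] := eqVneq x y.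
  by apply/eqP; rewrite gdist_eq0.
by apply/eqP; rewrite gdist_eq1 adjG.
Qed.

Lemma complete_bipartite_gdist (s : {set G}) : s != set0 -> ~: s != set0 ->
    (forall x y, adj x y = (x \in s) (+) (y \in s)) ->
  forall x y, gdist x y =
    if x == y then 0%N else if (x \in s) (+) (y \in s) then 1%N else 2.
Proof.
move=> /set0Pn[a a_s] /set0Pn[b]; rewrite inE => b_s adjG x y.
have [->|xy] := eqVneq x y; first by apply/eqP; rewrite gdist_eq0.
case: ifPn => side; first by apply/eqP; rewrite gdist_eq1 adjG.
apply/eqP; rewrite eqn_leq; apply/andP; split.
  move: side; case xs: (x \in s); case ys: (y \in s) => // _.
    by apply: (@gdist_le2 _ b) => //; rewrite adjG ?xs ?ys (negPf b_s).
  by apply: (@gdist_le2 _ a) => //; rewrite adjG ?xs ?ys a_s.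
have : (gdist x y != 1)%N by rewrite gdist_eq1 adjG.
have : (gdist x y != 0)%N by rewrite gdist_eq0.
by case: (gdist x y) => [|[]].
Qed.

End Distance.

(** * Recognising complete and complete bipartite graphs *)

Lemma isomorphic_complete (G : sgraph) (n : nat) :
  isomorphic G (complete_graph n) <->
  #|G| = n /\ forall x y : G, adj x y = (x != y).
Proof.
split=> [[f bij_f fE]|[cardG adjG]].
  split=> [|x y]; first by rewrite (bij_eq_card bij_f) card_ord.
  by rewrite -fE /= /complete_adj (bij_eq bij_f).
exists (cast_ord cardG \o enum_rank).
  apply: bij_comp; last exact: enum_rank_bij.
  by exists (cast_ord (esym cardG)); [apply: cast_ordK | apply: cast_ordKV].
by move=> x y; rewrite adjG /= /complete_adj (inj_eq (@cast_ord_inj _ _ _))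
  (inj_eq enum_rank_inj).
Qed.

(** [s] is the first part of the bipartition, and [(+)] the exclusive or. *)
Lemma isomorphic_complete_bipartite (G : sgraph) (a b : nat) :
  isomorphic G (complete_bipartite a b) <->
  exists s : {set G}, [/\ #|s| = a, #|~: s| = b &
    forall x y : G, adj x y = (x \in s) (+) (y \in s)].
Proof.
split=> [[f bij_f fE]|[s [card_s card_sC adjG]]].
  have [g fK gK] := bij_f.
  pose left (u : 'I_a + 'I_b) := if u is inl _ then true else false.
  exists [set x | left (f x)].
  have -> : [set x | left (f x)] = [set g (inl i) | i : 'I_a].
    apply/setP=> x; rewrite inE; apply/idP/imsetP => [|[i _ ->]]; last by rewrite gK.
    by case E: (f x) => [i|//] _; exists i => //; rewrite -E fK.
  have -> : ~: [set g (inl i) | i : 'I_a] = [set g (inr i) | i : 'I_b].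
    apply/setP=> x; rewrite inE; apply/idP/imsetP => [|[i _ ->]].
      case E: (f x) => [i|i]; last by exists i => //; rewrite -E fK.
      by move/imsetP; case; exists i => //; rewrite -E fK.
    by apply/imsetP => -[j _ /(can_inj gK)].
  split.
  - by rewrite card_imset ?card_ord // => i j /(can_inj gK)[].
  - by rewrite card_imset ?card_ord // => i j /(can_inj gK)[].
  - move=> x y; rewrite -fE.
    have side z : (z \in [set g (inl i) | i : 'I_a]) = left (f z).
      apply/imsetP/idP => [[i _ ->]|]; first by rewrite gK.
      by case E: (f z) => [i|//] _; exists i => //; rewrite -E fK.
    by rewrite !side; case: (f x) (f y) => [i|i] [j|j].
pose g (u : 'I_a + 'I_b) : G := match u with
  | inl i => enum_val (cast_ord (esym card_s) i)
  | inr i => enum_val (cast_ord (esym card_sC) i)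
  end.
have gs u : (g u \in s) = if u is inl _ then true else false.
  case: u => i /=; first exact: enum_valP.
  by apply/negbTE; have := enum_valP (cast_ord (esym card_sC) i); rewrite inE.
have inj_g : injective g.
  move=> u v E; have := gs u; rewrite E gs; move: E.
  by case: u v => i [] j //= /enum_val_inj/cast_ord_inj ->.
have [|f gK fK] := inj_card_bij inj_g.
  by rewrite card_sum !card_ord -card_s -card_sC cardsC.
exists f; first by exists g.
by move=> x y; rewrite adjG -[in RHS](fK x) -[in RHS](fK y) !gs; case: (f x) (f y) => ? [].
Qed.

(** * The distance matrix *)

Section DistanceMatrix.
Variables (R : rcfType) (G : sgraph).
Local Notation D x y := ((@gdist G x y)%:R : R).
Local Notation lambda2 := (lambda_ 2 (dist_mx G R)).

Lemma sum_enum_val (F : G -> R) : \sum_(i < #|G|) F (enum_val i) = \sum_x F x.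
Proof. exact: (esym (big_enum_val F)). Qed.

Lemma dist_mx_sym : (dist_mx G R)^T = dist_mx G R.
Proof. by apply/matrixP=> i j; rewrite !mxE gdist_sym. Qed.

(** The rows of the matrix are indexed by the ranks of the vertices; this lemma
    and the next one replace row vectors by functions on the vertices. *)
Lemma eigenvalue_dist_mx (f : G -> R) (a : R) :
    (exists x, f x != 0) -> (forall y, \sum_x f x * D x y = a * f y) ->
  eigenvalue (dist_mx G R) a.
Proof.
move=> [x fx] fD; apply/eigenvalueP; exists (\row_i f (enum_val i)).
  apply/rowP=> j; rewrite !mxE -fD -sum_enum_val.
  by apply: eq_bigr => i _; rewrite !mxE.
by apply: contra_neq fx => /rowP/(_ (enum_rank x)); rewrite !mxE enum_rankK.
Qed.

Lemma lambda2_dist_mx_test : (2 <= #|G|)%N ->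
  exists f : G -> R, [/\ exists x, f x != 0, \sum_x f x = 0 &
    lambda2 * (\sum_x f x ^+ 2) <= \sum_x \sum_y f x * f y * D x y].
Proof.
move=> n_ge2; have [v [v0 v1 vD]] :=
  lambda2_attained_orthogonal (const_mx 1) n_ge2 dist_mx_sym.
exists (fun x => v 0 (enum_rank x)); split.
- have [i vi] := rV0Pn _ v0; exists (enum_val i); by rewrite enum_valK.
- rewrite -[RHS]v1 /dot -sum_enum_val; apply: eq_bigr => i _.
  by rewrite mxE mulr1 enum_valK.
- move: vD; rewrite /dot; congr (_ * _ <= _).
    by rewrite -sum_enum_val; apply: eq_bigr => i _; rewrite enum_valK expr2.
  rewrite [RHS]exchange_big /= -sum_enum_val; apply: eq_bigr => j _.
  rewrite mxE big_distrl /= -sum_enum_val; apply: eq_bigr => i _.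
  by rewrite mxE !enum_valK mulrAC.
Qed.

End DistanceMatrix.

(** * The bound and its equality case *)

(** When [D] is a graph distance bounded by [d], the terms with [x != y] on
    the left are visibly nonnegative, and those with [x = y] add up to
    [4 d] times the squared norm of [f]. *)
Lemma sum_deficit (R : comNzRingType) (T : finType) (D : T -> T -> R) (d : R)
    (f : T -> R) : \sum_x f x = 0 ->
  \sum_x \sum_y ((d - D x y) * (f x + f y) ^+ 2 + (D x y - 1) * (f x - f y) ^+ 2)
  = 2 * (d - 1) * #|T|%:R * (\sum_x f x ^+ 2)
    - 4 * \sum_x \sum_y f x * f y * D x y.
Proof.
move=> f0; set S := \sum_x f x ^+ 2.
transitivity (\sum_x \sum_y ((d - 1) * f x ^+ 2 + (d - 1) * f y ^+ 2
    + 2 * (d + 1) * f x * f y - 4 * (f x * f y * D x y))).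
  by apply: eq_bigr => x _; apply: eq_bigr => y _; ring.
transitivity (\sum_x ((d - 1) * #|T|%:R * f x ^+ 2 + (d - 1) * S
    - 4 * \sum_y f x * f y * D x y)).
  apply: eq_bigr => x _; rewrite sumrB !big_split /= sumr_const -!mulr_sumr f0.
  by rewrite mulr0 addr0 -mulr_natl; congr (_ + _ - _); ring.
rewrite sumrB big_split /= sumr_const -!mulr_sumr -mulr_natl -/S.
ring.
Qed.

Section SecondEigenvalue.
Variables (R : rcfType) (G : sgraph).
Hypothesis connG : connected_graph G.
Hypothesis cardG : (2 <= #|G|)%N.

Local Notation D x y := ((@gdist G x y)%:R : R).
Local Notation lambda2 := (lambda_ 2 (dist_mx G R)).
Local Notation d := ((diameter G)%:R : R).
Local Notation n := (#|G|%:R : R).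

(** The claimed upper bound on the second distance eigenvalue. *)
Definition lambda2_bound : R := n * (d - 1) / 2%:R - d.

(** The contribution of a pair of vertices to (four times) the gap between
    the bound and the quadratic form of the distance matrix. *)
Definition deficit (f : G -> R) (x y : G) : R :=
  (d - D x y) * (f x + f y) ^+ 2 + (D x y - 1) * (f x - f y) ^+ 2.

Lemma gdist_ge1 x y : y != x -> 1 <= D x y.
Proof. by move=> yx; rewrite ler1n lt0n gdist_eq0 // eq_sym. Qed.

Lemma deficit_ge0 f x y : y != x -> 0 <= deficit f x y.
Proof.
move=> yx; rewrite addr_ge0 // mulr_ge0 ?sqr_ge0 // subr_ge0.
  by rewrite ler_nat gdist_le_diameter.
exact: gdist_ge1.
Qed.

Lemma sum_deficit_le : exists f : G -> R,
  [/\ 0 < \sum_x f x ^+ 2, \sum_x f x = 0 &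
      \sum_x \sum_(y | y != x) deficit f x y
        <= 4 * (lambda2_bound - lambda2) * \sum_x f x ^+ 2].
Proof.
have [f [[x0 fx0] f0 fD]] := lambda2_dist_mx_test R cardG; exists f; split=> //.
  rewrite (bigD1 x0) //= ltr_pwDl ?exprn_even_gt0 //.
  by apply: sumr_ge0 => x _; apply: sqr_ge0.
have := sum_deficit (fun x y => D x y) d f0.
have diag x : \sum_y deficit f x y
    = 4 * d * f x ^+ 2 + \sum_(y | y != x) deficit f x y.
  rewrite (bigD1 x) //=; congr (_ + _); rewrite /deficit.
  have /eqP -> : gdist x x == 0%N by rewrite gdist_eq0.
  by ring.
under eq_bigr do rewrite diag.
rewrite big_split /= -mulr_sumr => defF.
have -> : \sum_x \sum_(y | y != x) deficit f x y
  = 4 * lambda2_bound * (\sum_x f x ^+ 2) - 4 * \sum_x \sum_y f x * f y * D x y.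
  apply: (addrI (4 * d * \sum_x f x ^+ 2)); rewrite defF /lambda2_bound.
  by field.
by move: fD; lra.
Qed.

Lemma lambda2_le_bound : lambda2 <= lambda2_bound.
Proof.
have [f [S_gt0 _ le_f]] := sum_deficit_le.
rewrite -subr_ge0 -(pmulr_lge0 _ S_gt0) -(pmulr_rge0 _ (ltr0n _ 4)) // mulrA.
apply: le_trans le_f; apply: sumr_ge0 => x _; apply: sumr_ge0 => y.
exact: deficit_ge0.
Qed.

(** If the bound is attained, then all terms of the sum of nonnegative
    deficits vanish. *)
Lemma lambda2_eq_bound_vector : lambda2 = lambda2_bound ->
  exists f : G -> R, [/\ exists x, f x != 0, \sum_x f x = 0 &
    forall x y, y != x ->
      (d - D x y) * (f x + f y) ^+ 2 = 0 /\ (D x y - 1) * (f x - f y) ^+ 2 = 0].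
Proof.
move=> eq_l; have [f [S_gt0 f0]] := sum_deficit_le.
rewrite eq_l subrr mulr0 mul0r => le0; exists f; split=> //.
  apply/existsP; apply: contraTT S_gt0 => /existsPn f00.
  rewrite big1 ?ltxx // => x _; have /eqP-> := negbNE (f00 x).
  by rewrite expr0n.
have ge0 x : 0 <= \sum_(y | y != x) deficit f x y.
  by apply: sumr_ge0 => y; apply: deficit_ge0.
move=> x y yx; have : deficit f x y = 0.
  have sum0 : \sum_x \sum_(y | y != x) deficit f x y = 0.
    by apply/eqP; rewrite eq_le le0 sumr_ge0.
  have /psumr_eq0P := sum0; move/(_ (fun z _ => ge0 z) x isT) => sumx0.
  by have /psumr_eq0P := sumx0; apply=> // z; apply: deficit_ge0.
have t1 : 0 <= (d - D x y) * (f x + f y) ^+ 2.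
  by rewrite mulr_ge0 ?sqr_ge0 // subr_ge0 ler_nat gdist_le_diameter.
have t2 : 0 <= (D x y - 1) * (f x - f y) ^+ 2.
  by rewrite mulr_ge0 ?sqr_ge0 // subr_ge0 gdist_ge1.
by move/eqP; rewrite paddr_eq0 // => /andP[/eqP-> /eqP->].
Qed.

(** The vanishing of the deficits makes [f] change sign along edges and keep
    its value between distinct vertices which are not adjacent. Hence [f] takes
    only two opposite values, and it takes them equally often since its sum is
    zero. *)
Lemma lambda2_eq_bound_bipartition : lambda2 = lambda2_bound ->
    (1 < diameter G)%N ->
  exists s : {set G}, #|s| = #|~: s| /\
    forall x y, adj x y = (x \in s) (+) (y \in s).
Proof.
move=> /lambda2_eq_bound_vector[f [[x0 fx0] f0 fP]] d_gt1.
have cases x y : y != x -> if adj x y then f y = - f x else f y = f x.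
  move=> yx; have [e1 e2] := fP x y yx; case: ifPn => xy.
    have /eqP D1 : gdist x y == 1%N by rewrite gdist_eq1.
    move/eqP: e1; rewrite D1 mulf_eq0 subr_eq0 (eqr_nat _ _ 1) gtn_eqF //=.
    by rewrite sqrf_eq0 addrC addr_eq0 => /eqP.
  move/eqP: e2; rewrite mulf_eq0 subr_eq0 (eqr_nat _ _ 1) gdist_eq1 //.
  by rewrite (negPf xy) /= sqrf_eq0 subr_eq0 => /eqP.
have fpm x : f x = f x0 \/ f x = - f x0.
  have [->|xx0] := eqVneq x x0; first by left.
  by have := cases _ _ xx0; case: ifP; auto.
have fx0N : f x0 != - f x0 by rewrite -addr_eq0 -mulr2n mulrn_eq0.
exists [set x | f x == f x0]; split; last first.
  move=> x y; rewrite !inE; have [->|yx] := eqVneq y x.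
    by rewrite addbb adj_irrefl.
  have := cases _ _ yx; case: ifP => _ ->.
    by case: (fpm x) => ->; rewrite ?opprK ?eqxx [- _ == _]eq_sym (negPf fx0N).
  by rewrite addbb.
apply/eqP; rewrite -(eqr_nat R); move/eqP: f0.
rewrite (bigID (mem [set x | f x == f x0])) /=.
rewrite (eq_bigr (fun=> f x0)); last by move=> x; rewrite inE => /eqP.
rewrite [X in _ + X](eq_bigr (fun=> - f x0)); last first.
  by move=> x; rewrite inE; case: (fpm x) => -> //; rewrite eqxx.
rewrite !sumr_const mulNrn subr_eq0.
rewrite -[X in X == _]mulr_natr -[X in _ == X]mulr_natr.
have -> : #|[predC [set x | f x == f x0]]| = #|~: [set x | f x == f x0]|.
  by apply: eq_card => x; rewrite !inE.
by move/eqP/(mulfI fx0)->.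
Qed.

Lemma lambda2_complete : (forall x y : G, adj x y = (x != y)) ->
  lambda2 = lambda2_bound.
Proof.
move=> adjG; have gdE := complete_gdist connG adjG.
have /card_gt1P[x [y [_ _ xy]]] := cardG.
have d1 : diameter G = 1%N.
  apply/eqP; rewrite eqn_leq diameter_le => [|u v]; last first.
    by rewrite gdE leq_b1.
  by apply: leq_trans (gdist_le_diameter x y); rewrite gdE xy.
apply/eqP; rewrite eq_le lambda2_le_bound /lambda2_bound d1 subrr mulr0 mul0r.
rewrite sub0r /=.
have sumD (f : G -> R) z : \sum_u f u * D u z = \sum_u f u - f z.
  rewrite [in RHS](bigD1 z) //= (bigD1 z) //= gdE eqxx mulr0 add0r addrAC subrr.
  by rewrite add0r; apply: eq_bigr => u uz; rewrite gdE uz mulr1.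
have sum1 (w : G) : \sum_z (z == w)%:R = 1 :> R.
  by rewrite (bigD1 w) //= eqxx big1 ?addr0 // => u /negPf->.
apply: (@lt_eigenvalues_lambda2 _ _ _ _ (n - 1)).
- apply: (@eigenvalue_dist_mx _ _ (fun z => (z == x)%:R - (z == y)%:R)).
    by exists x; rewrite eqxx (negPf xy) subr0 oner_neq0.
  by move=> z; rewrite sumD sumrB !sum1 subrr mulN1r sub0r.
- apply: (@eigenvalue_dist_mx _ _ (fun=> 1)).
    by exists x; apply: oner_neq0.
  by move=> z; rewrite sumD sumr_const mulr1.
- by rewrite ltrBDr addNr ltr0n ltnW.
Qed.

(** In terms of the function [sg] equal to 1 on [s] and to -1 elsewhere,
    distances are [3 / 2 + sg x * sg y / 2], minus 2 on the diagonal; so the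
    constant function 1 and [sg] are eigenvectors. *)
Lemma lambda2_complete_bipartite (s : {set G}) : #|s| = #|~: s| ->
    (forall x y, adj x y = (x \in s) (+) (y \in s)) ->
  lambda2 = lambda2_bound.
Proof.
move=> card_s adjG; pose sg x : R := if x \in s then 1 else - 1.
have s_gt0 : (0 < #|s|)%N.
  by move: cardG; rewrite -(cardsC s) -card_s addnn; case: #|s|.
have gdE : forall x y, gdist x y =
    if x == y then 0%N else if (x \in s) (+) (y \in s) then 1%N else 2.
  by apply: complete_bipartite_gdist; rewrite // -card_gt0 -?card_s.
(* The graph K_{1,1} is complete and has diameter 1, not 2. *)
have [d_le1|d_gt1] := leqP (diameter G) 1.
  by apply: lambda2_complete => x y; apply: diameter_le1_complete.
have d2 : diameter G = 2.
  apply/eqP; rewrite eqn_leq d_gt1 andbT; apply: diameter_le => x y.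
  by rewrite gdE; case: ifP => // _; case: ifP.
have DE x y : D x y = 3 / 2 + sg x * sg y / 2 - 2 * (x == y)%:R.
  rewrite gdE /sg; have [<-|_] := eqVneq x y; first by case: ifP => _ /=; field.
  by case: (x \in s) (y \in s) => [] [] /=; field.
have sg_sum : \sum_x sg x = 0.
  rewrite (bigID (mem s)) /=.
  rewrite (eq_bigr (fun=> 1)); last by move=> x xs; rewrite /sg xs.
  rewrite [X in _ + X](eq_bigr (fun=> - 1)); last first.
    by move=> x xs; rewrite /sg (negPf xs).
  rewrite !sumr_const mulNrn.
  have -> : #|[predC s]| = #|~: s| by apply: eq_card => x; rewrite !inE.
  by rewrite card_s subrr.
have sg2 x : sg x ^+ 2 = 1 by rewrite /sg; case: ifP; rewrite ?sqrrN expr1n.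
have sumD (f : G -> R) y : \sum_x f x * D x y
    = 3 / 2 * (\sum_x f x) + sg y / 2 * (\sum_x f x * sg x) - 2 * f y.
  have -> : f y = \sum_x f x * (x == y)%:R.
    rewrite (bigD1 y) //= eqxx mulr1 big1 ?addr0 // => x /negPf->.
    by rewrite mulr0.
  rewrite !mulr_sumr -big_split -sumrB; apply: eq_bigr => x _ /=.
  by rewrite DE; ring.
have [a a_s] : exists a, a \in s by apply/set0Pn; rewrite -card_gt0.
apply/eqP; rewrite eq_le lambda2_le_bound /lambda2_bound d2 /=.
apply: (@lt_eigenvalues_lambda2 _ _ _ _ (3 / 2 * n - 2)).
- apply: (@eigenvalue_dist_mx _ _ sg).
    by exists a; rewrite /sg a_s oner_neq0.
  move=> y; rewrite sumD sg_sum.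
  under eq_bigr do rewrite -expr2 sg2.
  by rewrite sumr_const; field.
- apply: (@eigenvalue_dist_mx _ _ (fun=> 1)).
    by exists a; apply: oner_neq0.
  move=> y; rewrite sumD sumr_const.
  under eq_bigr do rewrite mul1r.
  by rewrite sg_sum; field.
- have : 0 < n by rewrite ltr0n ltnW.
  by lra.
Qed.

End SecondEigenvalue.

Theorem theorem2 (R : rcfType) (G : sgraph) (n d : nat)
    (connG : connected_graph G) (orderG : #|G| = n) (diamG : diameter G = d)
    (n_ge2 : (2 <= n)%N) :
  lambda_ 2 (dist_mx G R) <= n%:R * (d%:R - 1) / 2%:R - d%:R /\
  (lambda_ 2 (dist_mx G R) = n%:R * (d%:R - 1) / 2%:R - d%:R <->
   isomorphic G (complete_graph n) \/
   (~~ odd n /\ isomorphic G (complete_bipartite n./2 n./2))).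
Proof.
subst n d; rewrite -/(lambda2_bound R G); split; first exact: lambda2_le_bound.
split=> [eq_l|[/isomorphic_complete[_ adjG]|[_]]]; last 2 first.
- exact: lambda2_complete.
- case/isomorphic_complete_bipartite=> s [card_s card_sC adjG].
  by apply: lambda2_complete_bipartite adjG; rewrite ?card_s.
have [d_le1|d_gt1] := leqP (diameter G) 1.
  left; apply/isomorphic_complete; split=> // x y.
  exact: diameter_le1_complete.
have [s [card_s adjG]] := lambda2_eq_bound_bipartition connG n_ge2 eq_l d_gt1.
have card_G : #|G| = #|s|.*2 by rewrite -(cardsC s) -card_s addnn.
right; rewrite card_G odd_double doubleK; split=> //.
by apply/isomorphic_complete_bipartite; exists s.
Qed.
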